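(* Let $\Gamma$ be an ($n$-valent) torus graph, and let $(h_0,\dots,h_n)$ be the $h$-vector of the simplicial poset $\mathcal P(\Gamma)$. Then $$\sum_{i=0}^n(h_{n-i}-h_{i})t^i=\sum_{F\subseteq\Gamma}\bigl(1-\chi(F)\bigr)(t-1)^{\dim F},$$ where the sum is over all (non-empty) faces $F$ of $\Gamma$, including $\Gamma$ itself. In particular, the equations $h_i=h_{n-i}$ hold if $\chi(F)=1$ for every face $F$ of $\Gamma$.
   Context: Torus graphs. Let $T=T^n$; $H^2(BT)=\mathrm{Hom}(T,S^1)\cong\mathbb Z^n$. Let $\Gamma$ be a finite connected regular $n$-valent graph without loops (multiple edges allowed), $V(\Gamma)$ its vertices, $E(\Gamma)$ its oriented edges (each edge occurs with both orientations), $i(e),t(e)$ the initial and terminal vertices, $\bar e$ the reversed edge, $E(\Gamma)_p=\{e: i(e)=p\}$. A connection $\theta$ is a collection of bijections $\theta_e\colon E(\Gamma)_{i(e)}\to E(\Gamma)_{t(e)}$ with $\theta_{\bar e}=\theta_e^{-1}$ and $\theta_e(e)=\bar e$. A torus axial function is a map $\alpha\colon E(\Gamma)\to H^2(BT)$ such that (a) $\alpha(\bar e)=\pm\alpha(e)$; (b) $\alpha(E(\Gamma)_p)$ is a basis of $H^2(BT)$ for each vertex $p$; (c) $\alpha(\theta_e(e'))\equiv\alpha(e')\bmod\alpha(e)$ for all $e$ and $e'\in E(\Gamma)_{i(e)}$. The triple $(\Gamma,\alpha,\theta)$ is a torus graph. A $k$-dimensional face ($0\le k\le n$) is a connected regular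 $k$-valent subgraph of $\Gamma$ invariant under the connection (for every oriented edge $e$ of it, $\theta_e$ maps its edges at $i(e)$ to its edges at $t(e)$). The Euler number of a face $F$ is $\chi(F):=\sum_{H\subseteq F}(-1)^{\dim H}$, the sum over all (non-empty) faces $H$ contained in $F$, including $F$. A finite poset $\mathcal P$ is simplicial if it has an initial element $\hat 0$ and each lower segment $[\hat0,\sigma]$ is a boolean lattice; $\mathrm{rk}\,\sigma=k$ if $[\hat 0,\sigma]$ is the face poset of a $(k-1)$-simplex. The faces of $\Gamma$ ordered by reversed inclusion form a simplicial poset $\mathcal P(\Gamma)$ of rank $n$, in which $F$ has rank $n-\dim F$. If $f_i$ is the number of elements of rank $i+1$ ($f_{-1}=1$), the $h$-vector is defined by $\sum_{i=0}^nh_it^{n-i}=\sum_{i=0}^nf_{i-1}(t-1)^{n-i}$. *)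

(* Defs.v *)
From HB Require Import structures.
From mathcomp Require Import all_boot all_order all_algebra.

Set Implicit Arguments.
Unset Strict Implicit.
Unset Printing Implicit Defensive.

Import Order.TTheory GRing.Theory Num.Theory.
Local Open Scope ring_scope.

(** * Simplicial posets *)

Section Simplicial.
Variables (disp : Order.disp_t) (P : finBPOrderType disp).

(* [has_rank k s]: the lower segment [\bot, s] is isomorphic, as a poset, to
   the poset of all subsets of a k-element set, that is, to the poset of faces
   (the empty one included) of a (k-1)-simplex. *)
Definition has_rank (k : nat) (s : P) : bool :=
  [exists g : {ffun {set 'I_k} -> P},
    [forall A, forall B, (g A <= g B)%O == (A \subset B)] &&
    [forall x, (x \in codom g) == (\bot <= x <= s)%O]].

(* [fvec k] is f_{k-1}: the index is shifted so that f_{-1} is [fvec 0]. *)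
Definition fvec (k : nat) : nat := #|[set s : P | has_rank k s]|.

Definition hpoly (n : nat) : {poly int} :=
  \sum_(i < n.+1) (fvec i)%:R *: ('X - 1) ^+ (n - i).

(* Component h_i of the h-vector of a simplicial poset of rank n; see [hvecE]
   for the defining identity. *)
Definition hvec (n i : nat) : int := (hpoly n)`_(n - i).

Lemma hvecE (n : nat) :
  \sum_(i < n.+1) hvec n i *: 'X^(n - i) =
  \sum_(i < n.+1) (fvec i)%:R *: ('X - 1) ^+ (n - i) :> {poly int}.
Proof.
rewrite -/(hpoly n) (reindex_inj rev_ord_inj) /=.
have szh : (size (hpoly n) <= n.+1)%N.
  apply: (leq_trans (size_sum _ _ _)); apply/bigmax_leqP => i _.
  apply: (leq_trans (size_scale_leq _ _)).
  by rewrite size_exp_XsubC ltnS leq_subr.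
transitivity (\poly_(i < n.+1) (hpoly n)`_i).
  rewrite poly_def; apply: eq_bigr => i _.
  by rewrite subSS /hvec subKn // -ltnS ltn_ord.
apply/polyP => i; rewrite coef_poly; case: ltnP => // le_ni.
by rewrite nth_default // (leq_trans szh).
Qed.

End Simplicial.

(** * Graphs with oriented edges *)

(* Finite, without loops, multiple edges allowed.  Each geometric edge is the
   pair {e, rev e} of its orientations, which are distinct because the graph
   has no loops. *)
Record graph := Graph {
  vert : finType;
  edge : finType;
  ini : edge -> vert;
  ter : edge -> vert;
  rev : edge -> edge;
  revK : involutive rev;
  ini_rev : forall e, ini (rev e) = ter e;
  loopless : forall e, ini e != ter e
}.

(* A subgraph candidate: a set of vertices and a set of oriented edges. *)
Definition subgraph (Gamma : graph) : Type :=
  ({set vert Gamma} * {set edge Gamma})%type.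

Section Graphs.
Variable Gamma : graph.
Implicit Types (H K : subgraph Gamma) (p q : vert Gamma) (e : edge Gamma).

Definition full_subgraph : subgraph Gamma := (setT, setT).

Definition is_subgraph H : bool :=
  [forall e in H.2, [&& ini e \in H.1, ter e \in H.1 & rev e \in H.2]].

Definition star H p : {set edge Gamma} := [set e in H.2 | ini e == p].

Definition sub_adj H : rel (vert Gamma) :=
  [rel p q | [exists e in H.2, (ini e == p) && (ter e == q)]].

Definition sub_connected H : bool :=
  (H.1 != set0) &&
  [forall p in H.1, forall q in H.1, connect (sub_adj H) p q].

Definition sub_regular H (k : nat) : bool :=
  [forall p in H.1, #|star H p| == k].

Definition subgraph_le H K : bool := (H.1 \subset K.1) && (H.2 \subset K.2).

End Graphs.

(** * Torus graphs *)

(* H^2(BT) is identified with Z^n, written as row vectors.  The bijection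
   theta_e : E(Gamma)_{i(e)} -> E(Gamma)_{t(e)} is [theta e]; only its values
   on the edges issuing from [ini e] are meaningful.  It is a bijection by
   [theta_rev] applied to [e] and to [rev e]. *)
Record torus_graph (n : nat) := TorusGraph {
  tg_graph :> graph;
  tg_connected : sub_connected (full_subgraph tg_graph);
  tg_regular : sub_regular (full_subgraph tg_graph) n;
  theta : edge tg_graph -> edge tg_graph -> edge tg_graph;
  ini_theta : forall e e', ini e' = ini e -> ini (theta e e') = ter e;
  theta_rev : forall e e', ini e' = ini e -> theta (rev e) (theta e e') = e';
  theta_self : forall e, theta e e = rev e;
  axial : edge tg_graph -> 'rV[int]_n;
  axial_rev : forall e, axial (rev e) = axial e \/ axial (rev e) = - axial e;
  axial_free : forall (p : vert tg_graph) (c : edge tg_graph -> int),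
    \sum_(e | ini e == p) c e *: axial e = 0 ->
    forall e, ini e = p -> c e = 0;
  axial_span : forall (p : vert tg_graph) (v : 'rV[int]_n),
    exists c : edge tg_graph -> int, v = \sum_(e | ini e == p) c e *: axial e;
  axial_theta : forall e e', ini e' = ini e ->
    exists k : int, axial (theta e e') - axial e' = k *: axial e
}.

Section Faces.
Variables (n : nat) (G : torus_graph n).
Implicit Types (H : subgraph G) (k : nat).

Definition theta_invariant H : bool :=
  [forall e in H.2, theta e @: star H (ini e) == star H (ter e)].

Definition is_kface k H : bool :=
  [&& is_subgraph H, sub_connected H, sub_regular H k & theta_invariant H].

Record face := Face {
  face_sub :> subgraph G;
  faceP : [exists k : 'I_n.+1, is_kface k face_sub]
}.

HB.instance Definition _ := [isSub for face_sub].
HB.instance Definition _ := [Finite of face by <:].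

Implicit Types F : face.

Definition dimF F : nat := xchoose (existsP (faceP F)).

Lemma dimFP F : is_kface (dimF F) F.
Proof. exact: (xchooseP (existsP (faceP F))). Qed.

Lemma dimF_eq F k : is_kface k F -> dimF F = k.
Proof.
case/and4P=> _ /andP[/set0Pn[p pF] _] /forall_inP/(_ p pF)/eqP <- _.
by case/and4P: (dimFP F) => _ _ /forall_inP/(_ p pF)/eqP.
Qed.

Definition euler F : int :=
  \sum_(F' : face | subgraph_le F' F) (-1) ^+ dimF F'.

Definition face_le F1 F2 : bool := subgraph_le F2 F1.

Lemma face_le_refl : reflexive face_le.
Proof. by move=> F; rewrite /face_le /subgraph_le !subxx. Qed.

Lemma face_le_anti : antisymmetric face_le.
Proof.
move=> F1 F2 /andP[/andP[v21 e21] /andP[v12 e12]]; apply: val_inj => /=.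
rewrite [LHS]surjective_pairing [RHS]surjective_pairing.
by congr pair; apply/eqP; rewrite eqEsubset ?v12 ?v21 ?e12 ?e21.
Qed.

Lemma face_le_trans : transitive face_le.
Proof.
move=> F2 F1 F3 /andP[v21 e21] /andP[v32 e32].
by rewrite /face_le /subgraph_le (subset_trans v32 v21) (subset_trans e32 e21).
Qed.

Lemma full_is_kface : is_kface n (full_subgraph G).
Proof.
rewrite /is_kface tg_connected tg_regular /=; apply/andP; split.
  by apply/forall_inP => e _; rewrite !inE.
have ter_rev (e : edge G) : ter (rev e) = ini e by rewrite -ini_rev revK.
apply/forall_inP => e _; apply/eqP/setP => e1; rewrite !inE /=.
apply/imsetP/eqP => [[e' + ->]|e1e].
  by rewrite !inE => /eqP/ini_theta.
have e1r : ini e1 = ini (rev e) by rewrite ini_rev.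
exists (theta (rev e) e1).
  by rewrite !inE /= (ini_theta e1r) ter_rev.
by rewrite -{1}(theta_rev e1r) revK.
Qed.

Lemma full_faceP : [exists k : 'I_n.+1, is_kface k (full_subgraph G)].
Proof. by apply/existsP; exists ord_max; exact: full_is_kface. Qed.

(* The graph itself, as a face. *)
Definition full_face : face := Face full_faceP.

Lemma full_face_le F : face_le full_face F.
Proof. by rewrite /face_le /subgraph_le !subsetT. Qed.

End Faces.

Fact face_display : Order.disp_t. Proof. exact: Order.Disp tt tt. Qed.

(* The poset P(Gamma): faces ordered by reversed inclusion. *)
HB.instance Definition _ (n : nat) (G : torus_graph n) :=
  Order.Le_isPOrder.Build face_display (face G)
    (@face_le_refl n G) (@face_le_anti n G) (@face_le_trans n G).

HB.instance Definition _ (n : nat) (G : torus_graph n) :=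
  Order.hasBottom.Build face_display (face G) (@full_face_le n G).

(* Main.v *)
(** Fix a vertex p and a set S of edges issuing from p.  By the congruence
    axiom the connection preserves the set of edges whose label lies in the span
    of the labels of S, so the component of p in the graph of those edges is a
    face; it has star S at p because the labels at p form a basis.  Conversely,
    for faces through p, inclusion is detected by the stars at p.  Hence the
    faces containing a face F of dimension d form a boolean lattice of rank
    n - d, and with x = t - 1,
      sum_{K >= F} x^(dim K) = x^d t^(n-d).
    Exchanging the sums in sum_F chi(F) x^(dim F) gives
    sum_F t^(n - dim F) (1 - t)^(dim F), the reversal of the polynomial
    sum_F (t - 1)^(dim F) = sum_i h_(n-i) t^i. *)

Require Import Defs.
From HB Require Import structures.
From mathcomp Require Import all_boot all_order all_algebra.

Set Implicit Arguments.
Unset Strict Implicit.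
Unset Printing Implicit Defensive.

Import Order.TTheory GRing.Theory Num.Theory.
Local Open Scope ring_scope.

Local Notation rev := Defs.rev.

(** The size of the lower segment determines [k], so an element has at most one rank. *)
Lemma has_rank_card (disp : Order.disp_t) (P : finBPOrderType disp) (k : nat)
    (s : P) : has_rank k s -> #|[set x : P | (x <= s)%O]| = (2 ^ k)%N.
Proof.
case/existsP=> g /andP[/forallP gle /forallP gim].
have ginj : injective g.
  move=> A B gAB; apply/eqP; rewrite eqEsubset.
  by rewrite -!(eqP (forallP (gle _) _)) gAB lexx.
rewrite -[X in (2 ^ X)%N]card_ord -cardsT -card_powerset powersetT cardsT.
rewrite -(card_codom ginj); apply: eq_card => x.
by rewrite inE (eqP (gim x)) le0x.
Qed.

Lemma sub_connect_ind (Gamma : graph) (H : subgraph Gamma)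
    (P : vert Gamma -> Prop) p q :
    (forall e, e \in H.2 -> P (ini e) -> P (ter e)) -> P p ->
  connect (sub_adj H) p q -> P q.
Proof.
move=> step Pp /connectP[s]; elim: s p Pp => [p Pp _ ->//|q' s IH p Pp /=].
case/andP=> /exists_inP[e eH /andP[/eqP ip /eqP tq']]; apply: IH.
by rewrite -tq'; apply: step; rewrite ?ip.
Qed.

Lemma ter_rev (Gamma : graph) (e : edge Gamma) : ter (rev e) = ini e.
Proof. by rewrite -ini_rev Defs.revK. Qed.

Section TorusGraph.
Variables (n : nat) (G : torus_graph n).
Implicit Types (p q : vert G) (e : edge G) (v : 'rV[int]_n).
Implicit Types (S : {set edge G}) (F K : face G).

Lemma theta_inj e : {in [pred e' | ini e' == ini e] &, injective (theta e)}.
Proof.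
by move=> a b /eqP ha /eqP hb hab; rewrite -(theta_rev ha) hab theta_rev.
Qed.

Lemma theta_rev' e e' : ini e' = ter e -> theta e (theta (rev e) e') = e'.
Proof. by rewrite -ini_rev => /theta_rev; rewrite Defs.revK. Qed.

(** * Coordinates with respect to the basis of labels at a vertex *)

Section Coordinates.
Variable p : vert G.

(** Stated with finite functions and a boolean equation so that [xchoose] can pick the coefficients.
    Only their values at edges issuing from [p] are determined. *)
Fact coord_subproof v :
  exists c : {ffun edge G -> int}, v == \sum_(e | ini e == p) c e *: axial e.
Proof.
have [c ->] := axial_span p v; exists (finfun c); apply/eqP.
by apply: eq_bigr => e _; rewrite ffunE.
Qed.

Definition axial_coord v : edge G -> int := xchoose (coord_subproof v).

Lemma axial_coordE v : v = \sum_(e | ini e == p) axial_coord v e *: axial e.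
Proof. exact/eqP/(xchooseP (coord_subproof v)). Qed.

Lemma axial_coord_uniq (c : edge G -> int) v :
    v = \sum_(e | ini e == p) c e *: axial e ->
  forall e, ini e = p -> axial_coord v e = c e.
Proof.
move=> vE e ep; apply/eqP; rewrite -subr_eq0; apply/eqP.
apply: (axial_free (p := p) (c := fun e => axial_coord v e - c e)) ep.
under eq_bigr do rewrite scalerBl.
by rewrite sumrB -vE -axial_coordE subrr.
Qed.

Lemma axial_coord_linear (a : int) u v e : ini e = p ->
  axial_coord (a *: u + v) e = a * axial_coord u e + axial_coord v e.
Proof.
move=> ep; pose c e := a * axial_coord u e + axial_coord v e.
apply: (axial_coord_uniq (c := c)) ep.
rewrite {1}(axial_coordE u) {1}(axial_coordE v) scaler_sumr -big_split /=.
by apply: eq_bigr => e' _; rewrite scalerDl scalerA.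
Qed.

Lemma axial_coord_axial e e' : ini e = p -> ini e' = p ->
  axial_coord (axial e) e' = (e' == e)%:R.
Proof.
move=> ep; apply: (axial_coord_uniq (c := fun x => (x == e)%:R)).
rewrite (bigD1 e) ?ep //= eqxx scale1r big1 ?addr0 // => x /andP[_ /negPf->].
by rewrite scale0r.
Qed.

(** Because the labels at [p] form a basis, the vanishing of the coordinates outside [S] decides
    membership in the integral span of the labels of the edges of [S] at [p]. *)
Definition in_axial_span S v : bool :=
  [forall (e | (ini e == p) && (e \notin S)), axial_coord v e == 0].

Lemma in_axial_span_linear S (a : int) u v :
  in_axial_span S u -> in_axial_span S v -> in_axial_span S (a *: u + v).
Proof.
move=> /forall_inP uS /forall_inP vS; apply/forall_inP => e eS.
have /andP[/eqP ep _] := eS.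
by rewrite axial_coord_linear // (eqP (uS e eS)) (eqP (vS e eS)) mulr0 addr0.
Qed.

Lemma in_axial_span_axial S e : ini e = p ->
  in_axial_span S (axial e) = (e \in S).
Proof.
move=> ep; apply/forall_inP/idP => [eS|eS e' /andP[/eqP e'p e'S]].
  apply: contraT => neS; have := eS e; rewrite ep eqxx neS => /(_ isT).
  by rewrite axial_coord_axial // eqxx.
by rewrite axial_coord_axial //; case: (e' =P e) e'S => // ->; rewrite eS.
Qed.

Lemma in_axial_span_rev S e :
  in_axial_span S (axial (rev e)) = in_axial_span S (axial e).
Proof.
have imp f : in_axial_span S (axial f) -> in_axial_span S (axial (rev f)).
  move=> fS; case: (axial_rev f) => -> //.
  (* With v the label of [f], -v is written as (-1)v + 0, and then 0 as (-1)v + v, so that closure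
     under [a *: u + v] suffices. *)
  rewrite -scaleN1r -[-1 *: _]addr0; apply: in_axial_span_linear => //.
  rewrite -(addNr (axial f)) -scaleN1r; exact: in_axial_span_linear.
by apply/idP/idP => /imp //; rewrite Defs.revK.
Qed.

(** The congruence axiom says that the two labels differ by a multiple of [axial e], which lies in
    the span. *)
Lemma in_axial_span_theta S e e' :
    in_axial_span S (axial e) -> ini e' = ini e ->
  in_axial_span S (axial (theta e e')) = in_axial_span S (axial e').
Proof.
move=> eS /axial_theta[k /eqP]; rewrite subr_eq => /eqP thE.
apply/idP/idP => h; last by rewrite thE; exact: in_axial_span_linear.
have -> : axial e' = - k *: axial e + axial (theta e e').
  by rewrite thE addrA -scalerDl addNr scale0r add0r.
exact: in_axial_span_linear.
Qed.

End Coordinates.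

Lemma card_full_star p : #|star (full_subgraph G) p| = n.
Proof.
by have /forall_inP reg := tg_regular G; apply/eqP/reg; rewrite in_setT.
Qed.

(** * The face through a vertex with prescribed star *)

Section FaceThrough.
Variables (p : vert G) (S : {set edge G}).
Hypothesis sSp : S \subset star (full_subgraph G) p.

Let span_edges : {set edge G} := [set e | in_axial_span p S (axial e)].
Let comp : {set vert G} :=
  [set q | connect (sub_adj ((setT, span_edges) : subgraph G)) p q].

(* The connected component of [p] in the graph of all edges whose label lies in
   the span of the labels of [S]. *)
Definition face_through_sub : subgraph G :=
  (comp, [set e in span_edges | ini e \in comp]).
Local Notation H := face_through_sub.

Let base_comp : p \in comp. Proof. by rewrite inE connect0. Qed.

Let ter_comp e : e \in span_edges -> ini e \in comp -> ter e \in comp.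
Proof.
move=> eS; rewrite !inE => /connect_trans; apply; apply: connect1.
by apply/exists_inP; exists e; rewrite //= !eqxx.
Qed.

Let H_rev e : e \in H.2 -> rev e \in H.2.
Proof.
rewrite !in_set /= => /andP[eS ei].
rewrite in_axial_span_rev eS ini_rev.
by have := @ter_comp e; rewrite !in_set; apply.
Qed.

Let H_connect q : q \in comp -> connect (sub_adj H) p q.
Proof.
rewrite inE => pq.
(* Both claims travel together along the path: an edge of [span_edges] belongs to [H] only once its
   initial vertex is known to be in [comp]. *)
pose P x := x \in comp /\ connect (sub_adj H) p x.
suff: P q by case.
apply: (sub_connect_ind (P := P)) pq => [e eS [ei pe]|]; last by split.
split; first exact: ter_comp.
apply: connect_trans pe _; apply: connect1; apply/exists_inP; exists e.
  by rewrite inE eS.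
by rewrite /= !eqxx.
Qed.

Lemma star_face_through : star H p = S.
Proof.
apply/setP => e; rewrite !inE /=; apply/idP/idP => [/andP[/andP[eS _] /eqP ep]|eS].
  by rewrite in_axial_span_axial in eS.
have := subsetP sSp e eS; rewrite !inE /= => /eqP ep.
by rewrite in_axial_span_axial // eS ep eqxx connect0.
Qed.

Let star_theta e : e \in H.2 -> theta e @: star H (ini e) = star H (ter e).
Proof.
rewrite inE => /andP[eS ei]; have eS' := eS; rewrite inE in eS'.
apply/setP => e'; apply/imsetP/idP => [[x + ->]|].
  rewrite !inE /= => /andP[/andP[xS _] /eqP xi].
  rewrite (in_axial_span_theta eS') // xS ini_theta // eqxx andbT.
  by have := ter_comp eS ei; rewrite inE.
rewrite !inE /= => /andP[/andP[e'S _] /eqP e'i].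
have e'i' : ini e' = ini (rev e) by rewrite ini_rev.
have xi : ini (theta (rev e) e') = ini e by rewrite ini_theta // ter_rev.
exists (theta (rev e) e'); last by rewrite theta_rev'.
rewrite !inE xi eqxx in_axial_span_theta ?in_axial_span_rev // e'S.
by move: ei; rewrite inE => ->.
Qed.

Lemma face_through_subP : is_kface #|S| H.
Proof.
apply/and4P; split.
- apply/forall_inP => e eH; have := eH; rewrite /= inE => /andP[eS ei].
  by rewrite ei ter_comp // H_rev.
- apply/andP; split; first by apply/set0Pn; exists p.
  apply/forall_inP => q qH; apply/forall_inP => r rH.
  apply: connect_trans (H_connect rH).
  (* Any two vertices are joined through [p]; going back to [p] uses the reversed edges. *)
  rewrite sym_connect_sym ?H_connect // => x y.
  by apply/exists_inP/exists_inP => -[e eH /andP[xi yt]]; exists (rev e);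
     rewrite ?H_rev // ini_rev ter_rev xi yt.
- apply/forall_inP => q /H_connect.
  (* The valency is #|S| at [p] and is carried along paths by the bijections [theta e] between
     stars. *)
  apply: (sub_connect_ind (P := fun x => #|star H x| == #|S|)) => [e eH|].
    move=> /eqP <-; rewrite -star_theta // card_in_imset // => a b.
    by rewrite !inE => /andP[_ ai] /andP[_ bi]; apply: theta_inj.
  by rewrite star_face_through.
- by apply/forall_inP => e eH; apply/eqP/star_theta.
Qed.

Lemma face_throughP : [exists k : 'I_n.+1, is_kface k H].
Proof.
have Sn : (#|S| < n.+1)%N.
  by rewrite ltnS (leq_trans (subset_leq_card sSp)) ?card_full_star.
by apply/existsP; exists (Ordinal Sn); exact: face_through_subP.
Qed.

Definition face_through : face G := Face face_throughP.

Lemma dim_face_through : dimF face_through = #|S|.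
Proof. exact/dimF_eq/face_through_subP. Qed.

Lemma mem_face_through : p \in (face_through : subgraph G).1.
Proof. exact: base_comp. Qed.

End FaceThrough.

(** * Faces through a common vertex, compared by their stars *)

Lemma face_edge_ini F e : e \in (F : subgraph G).2 -> ini e \in (F : subgraph G).1.
Proof. by case/and4P: (dimFP F) => /forall_inP h _ _ _ /h/and3P[]. Qed.

Lemma card_star F p : p \in (F : subgraph G).1 -> #|star F p| = dimF F.
Proof. by case/and4P: (dimFP F) => _ _ /forall_inP h _ /h/eqP. Qed.

Lemma face_nonempty F : exists p, p \in (F : subgraph G).1.
Proof. by case/and4P: (dimFP F) => _ /andP[/set0Pn]. Qed.

Lemma star_full F p : star F p \subset star (full_subgraph G) p.
Proof. by apply/subsetP => e; rewrite !inE => /andP[]. Qed.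

(* The connection propagates the inclusion of stars at [p] along paths of [F]. *)
Lemma subface_star F K p :
    p \in (F : subgraph G).1 -> p \in (K : subgraph G).1 ->
  subgraph_le F K = (star F p \subset star K p).
Proof.
move=> pF pK; apply/idP/idP => [/andP[_ /subsetP FK]|FKp].
  by apply/subsetP => e; rewrite !inE => /andP[/FK-> ->].
have FK q : q \in (F : subgraph G).1 ->
    q \in (K : subgraph G).1 /\ star F q \subset star K q.
  case/and4P: (dimFP F) => _ /andP[_ Fc] _ /forall_inP Fth.
  have /forall_inP/(_ q) Fpq := forall_inP Fc p pF.
  pose P x := x \in (K : subgraph G).1 /\ star F x \subset star K x.
  move=> /Fpq; apply: (sub_connect_ind (P := P)) => // e eF [ei eFK].
  have eK : e \in (K : subgraph G).2.
    by have /(subsetP eFK) : e \in star F (ini e); rewrite inE ?eF ?eqxx // => /andP[].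
  case/and4P: (dimFP K) => /forall_inP/(_ e eK)/and3P[_ et _] _ _.
  move=> /forall_inP/(_ e eK)/eqP Kth; split=> //.
  by rewrite -(eqP (Fth e eF)) -Kth imsetS.
apply/andP; split; apply/subsetP; first by move=> q /FK[].
move=> e eF.
have [_ /subsetP/(_ e)] := FK _ (face_edge_ini eF).
by rewrite !inE eF eqxx => /(_ isT)/andP[].
Qed.

Lemma face_subset_mem F K p :
  subgraph_le F K -> p \in (F : subgraph G).1 -> p \in (K : subgraph G).1.
Proof. by case/andP=> /subsetP FK _ /FK. Qed.

Lemma dim_face_le F : (dimF F <= n)%N.
Proof.
have [p pF] := face_nonempty F.
rewrite -(card_star pF) (leq_trans (subset_leq_card (star_full F p))) //.
by rewrite card_full_star.
Qed.

(** For [p] in [F], the subset [A] records which edges at [p] outside [F] are left out of the larger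
    face. Taking complements matches the reversed order on faces, so a larger [A] gives a smaller
    face and each element of [A] lowers the dimension by one. *)
Lemma lower_segment_boolean F :
  exists g : {set 'I_(n - dimF F)} -> face G,
    [/\ forall A B, (g A <= g B)%O = (A \subset B),
        forall K, (K <= F)%O -> exists A, K = g A,
        forall A, (g A <= F)%O &
        forall A, (dimF (g A) + #|A|)%N = n].
Proof.
have [p pF] := face_nonempty F.
pose D := star (full_subgraph G) p :\: star F p.
(* The index type becomes 'I_#|D|, so that [enum_val] identifies it with [D]. *)
have -> : (n - dimF F)%N = #|D|.
  rewrite cardsD (setIidPr (star_full F p)).
  by rewrite card_full_star (card_star pF).
pose X (A : {set 'I_#|D|}) := star (full_subgraph G) p :\: enum_val @: A.
have Xs A : X A \subset star (full_subgraph G) p by exact: subsetDl.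
have imD (A : {set 'I_#|D|}) : enum_val @: A \subset D.
  by apply/subsetP => _ /imsetP[i _ ->]; exact: enum_valP.
have imfull (A : {set 'I_#|D|}) : enum_val @: A \subset star (full_subgraph G) p.
  exact: subset_trans (imD A) (subsetDl _ _).
have stX A : star (face_through (Xs A)) p = X A by exact: star_face_through.
have FX A : star F p \subset X A.
  rewrite subsetD star_full disjoint_sym.
  by apply: disjointWl (imD A) _; rewrite -setI_eq0 setIDAC setDIl setDv setI0.
exists (fun A => face_through (Xs A)); split.
- move=> A B; rewrite [LHS](subface_star (mem_face_through _) (mem_face_through _)).
  rewrite !stX; apply/subsetP/subsetP => [XBA i iA|AB e].
    apply: contraT => iB; have := XBA (enum_val i).
    rewrite !inE (mem_imset _ _ enum_val_inj) iB (mem_imset _ _ enum_val_inj) iA /=.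
    by have := enum_valP i; rewrite !inE => /andP[_ /= ->] /(_ isT).
  rewrite !inE => /andP[eB ->]; rewrite andbT; apply: contra eB.
  by case/imsetP=> i /AB iB ->; rewrite imset_f.
- move=> K FK; have pK := face_subset_mem FK pF.
  have FKs : star F p \subset star K p by rewrite -subface_star.
  (* The preimage of a face is the set of edges of [D] that it misses. *)
  exists [set i | enum_val i \notin star K p].
  set A := [set i | _].
  have stK : star K p = X A.
    apply/setP => e; rewrite /X in_setD; apply/idP/andP => [eK|[eA efull]].
      split; last exact: (subsetP (star_full K p)).
      by apply: contraL eK => /imsetP[i + ->]; rewrite inE.
    apply: contraT => eK; case/negP: eA.
    have eD : e \in D by rewrite in_setD efull (contra (subsetP FKs e)).
    by rewrite -(enum_rankK_in eD eD) imset_f // inE enum_rankK_in.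
  apply/le_anti/andP; split;
    rewrite [(_ <= _)%O](subface_star (p := p)) ?mem_face_through //.
    by rewrite stX stK.
  by rewrite stX stK.
- move=> A; rewrite [(_ <= _)%O](subface_star (p := p)) ?mem_face_through //.
  by rewrite stX.
- move=> A; rewrite dim_face_through cardsD (setIidPr (imfull A)).
  rewrite card_full_star (card_imset _ enum_val_inj) subnK //.
  rewrite -(card_imset _ (@enum_val_inj _ (mem D))).
  by rewrite (leq_trans (subset_leq_card (imfull A))) ?card_full_star.
Qed.

(** * Ranks and generating polynomials of faces *)

Lemma has_rank_dim F (k : nat) : has_rank k F = (k == n - dimF F)%N.
Proof.
have rkF : has_rank (n - dimF F) F.
  have [g [gle gsur gF _]] := lower_segment_boolean F.
  apply/existsP; exists (finfun g); apply/andP; split.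
    by apply/forallP => A; apply/forallP => B; rewrite !ffunE gle.
  apply/forallP => K; rewrite le0x /=; apply/eqP; apply/codomP/idP => [[A ->]|KF].
    by rewrite ffunE gF.
  by have [A ->] := gsur K KF; exists A; rewrite ffunE.
apply/idP/eqP => [/has_rank_card|-> //].
by rewrite (has_rank_card rkF) => /eqP; rewrite eqn_exp2l // => /eqP.
Qed.

Lemma hpoly_dim : hpoly (face G) n = \sum_(F : face G) ('X - 1) ^+ dimF F.
Proof.
transitivity (\sum_(i < n.+1) \sum_(F : face G | has_rank i F)
    ('X - 1) ^+ (n - i) : {poly int}).
  apply: eq_bigr => i _; rewrite sumr_const /fvec cardsE -scaler_nat.
  by congr (_ *: _).
rewrite (exchange_big_dep xpredT) //=; apply: eq_bigr => F _.
(* A face has the single rank n - dim F, so it contributes one term, with exponent n - (n - dim F) =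
   dim F. *)
rewrite (big_pred1 (inord (n - dimF F))) => [|i].
  by rewrite inordK ?ltnS ?leq_subr // subKn ?dim_face_le.
by rewrite has_rank_dim /= -val_eqE /= inordK // ltnS leq_subr.
Qed.

Lemma sum_superfaces (x : {poly int}) F :
  \sum_(K : face G | subgraph_le F K) x ^+ dimF K
    = x ^+ dimF F * (x + 1) ^+ (n - dimF F).
Proof.
have [g [gle gsur gF gdim]] := lower_segment_boolean F.
have ginj : injective g.
  by move=> A B gAB; apply/eqP; rewrite eqEsubset -!gle gAB lexx.
rewrite (eq_bigl (fun K => K \in g @: setT)) => [|K]; last first.
  by apply/idP/imsetP => [/gsur[A ->]|[A _ ->]]; [exists A | exact: gF].
rewrite big_imset => [|A B _ _ /ginj //] /=.
(* The power is expanded as a product of factors 1 + x over the index set. The order of the summands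
   matters: indices in [A] select 1, since their edges are left out of the face, and the others
   select x. *)
rewrite -[X in _ * _ ^+ X]card_ord -prodr_const addrC bigA_distr mulr_sumr.
apply: eq_big => [A|A _]; first by rewrite !inE.
rewrite (bigID (mem A)) /= big1 => [|i ->//]; rewrite mul1r.
under eq_bigr => i /negPf-> do [].
rewrite prodr_const -exprD; congr (_ ^+ _).
have AC := cardC (mem A); rewrite card_ord in AC.
apply: (@addIn #|A|).
by rewrite gdim -addnA [X in (_ + X)%N]addnC AC subnKC ?dim_face_le.
Qed.

End TorusGraph.

(** Reversing coefficients in degree m + d substitutes 1/t for t and multiplies by t^(m+d), and
    t^(m+d) (1/t - 1)^d = t^m (1 - t)^d. The induction on [d] avoids fractions. *)
Lemma coef_rev_exp_subX1 (R : comNzRingType) (m d : nat) :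
  \poly_(i < (m + d).+1) (('X - 1) ^+ d : {poly R})`_(m + d - i)
    = 'X^m * (1 - 'X) ^+ d.
Proof.
elim: d => [|d IH].
  rewrite addn0 !expr0 mulr1; apply/polyP => i; rewrite coef_poly coef1 coefXn.
  by rewrite ltnS subn_eq0 eqn_leq; case: leqP.
rewrite addnS exprSr [in RHS]exprSr mulrA -IH; apply/polyP => i.
rewrite coef_poly !(mulrBr, mulr1) !coefB !coefMX !coef_poly.
(* For the constant coefficient the reversed index is m + d + 1, beyond the degree of the old
   power. *)
have szd : (('X - 1 : {poly R}) ^+ d)`_(m + d).+1 = 0.
  by rewrite nth_default // size_exp_XsubC ltnS leq_addl.
case: i => [|i] /=; first by rewrite !subn0 szd !subr0.
rewrite subSS !ltnS; case: (ltnP i (m + d)) => [i_lt|le_i].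
  by rewrite ltnW // subn_eq0 leqNgt i_lt /= subnS.
move: le_i; rewrite leq_eqVlt => /predU1P[<-|i_gt].
  by rewrite subnn leqnn.
by rewrite leqNgt i_gt subr0.
Qed.

Theorem corollary9p3 (n : nat) (G : torus_graph n) :
  let h := hvec (face G) n in
  \sum_(i < n.+1) (h (n - i)%N - h i) *: 'X^i
    = \sum_(F : face G) (1 - euler F) *: ('X - 1) ^+ dimF F :> {poly int}
  /\ ((forall F : face G, euler F = 1) ->
      forall i : nat, (i <= n)%N -> h i = h (n - i)%N).
Proof.
move=> h.
have hE : \sum_(i < n.+1) (h (n - i)%N - h i) *: 'X^i
    = \sum_(F : face G) (1 - euler F) *: ('X - 1) ^+ dimF F :> {poly int}.
  under [RHS]eq_bigr do rewrite scalerBl scale1r.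
  under [LHS]eq_bigr do rewrite scalerBl.
  rewrite !sumrB -hpoly_dim; congr (_ - _).
    (* The value h (n - i) is the i-th coefficient of [hpoly], whose degree is at most n because
       dimensions of faces are. *)
    rewrite /= -(poly_def n.+1 (fun i => h (n - i)%N)); apply/polyP => i.
    rewrite coef_poly.
    case: ltnP => [i_le|n_lt]; first by rewrite /h /hvec subKn.
    rewrite nth_default // hpoly_dim (leq_trans (size_sum _ _ _)) //.
    apply/bigmax_leqP => F _; rewrite size_exp_XsubC.
    by rewrite (leq_trans _ n_lt) // ltnS dim_face_le.
  (* The sum of the h_i t^i is the reversal of [hpoly] in degree n, computed one face at a time with
     m = n - dim F and d = dim F. *)
  transitivity (\sum_(F : face G)
      'X^(n - dimF F) * (1 - 'X) ^+ dimF F : {poly int}).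
    have nE F : n = (n - @dimF n G F + dimF F)%N by rewrite subnK ?dim_face_le.
    rewrite -poly_def; apply/polyP => i; rewrite coef_poly coef_sum.
    under eq_bigr => F _ do rewrite -coef_rev_exp_subX1 -nE coef_poly.
    by case: ifP => _; [rewrite /h /hvec hpoly_dim coef_sum | rewrite big1].
  under [RHS]eq_bigr => F _ do rewrite /euler scaler_suml.
  rewrite (exchange_big_dep xpredT) //=; apply: eq_bigr => F _.
  (* At x = t - 1 the factor x + 1 becomes t, and the sign (-1)^(dim F) turns (t - 1)^(dim F) into
     (1 - t)^(dim F). *)
  rewrite -scaler_sumr sum_superfaces subrK scalerAl -exprZn scaleN1r opprB.
  exact: mulrC.
split=> // euler1 i le_in; apply/eqP; rewrite eq_sym -subr_eq0; apply/eqP.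
have := congr1 (fun p : {poly int} => p`_i) hE.
rewrite -(poly_def n.+1 (fun i => h (n - i)%N - h i)) coef_poly ltnS le_in.
by move=> ->; rewrite big1 ?coef0 // => F _; rewrite euler1 subrr scale0r.
Qed.
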